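(* Let $p = p(n)$ satisfy $p / \left(\frac{\log n}{n}\right)^{1/6} \to \infty$ as $n \to \infty$. Then with probability tending to $1$ as $n\to\infty$, the random graph $G = G(n,p)$ satisfies $\mathrm{tc}_3(G) \leq 3$; that is, for every colouring of the edges of $G$ with three colours there exist three monochromatic trees $T_1, T_2, T_3$ in $G$ (each $T_i$ a subgraph of $G$ that is a tree all of whose edges have the same colour; a single vertex counts as a tree) such that $V(G) = V(T_1) \cup V(T_2) \cup V(T_3)$.
   Context: $G(n,p)$ denotes the binomial random graph on $n$ vertices in which each pair of vertices is an edge independently with probability $p$. For a graph $G$ and integer $r$, $\mathrm{tc}_r(G)$ is the minimum number $k$ such that in any $r$-edge-colouring of $G$ there are $k$ monochromatic trees whose vertex sets together cover $V(G)$. *)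

(* Defs.v *)
From mathcomp Require Import all_boot all_order all_algebra.
From mathcomp Require Import boolp reals.
Set Implicit Arguments.
Unset Strict Implicit.
Unset Printing Implicit Defensive.
Import Order.TTheory GRing.Theory Num.Theory.
Local Open Scope ring_scope.

(* A simple graph with vertex set T is its set of edges: a subset of [pairs T]. *)
Definition pairs (T : finType) : {set {set T}} := [set e : {set T} | #|e| == 2%N].

Definition adj (T : finType) (F : {set {set T}}) : rel T :=
  fun x y => [set x; y] \in F.

Definition is_graph (T : finType) (V : {set T}) (F : {set {set T}}) : Prop :=
  forall e : {set T}, e \in F -> e \in pairs T /\ e \subset V.

Definition connected_graph (T : finType) (V : {set T}) (F : {set {set T}}) : Prop :=
  V != set0 /\ forall x y : T, x \in V -> y \in V -> connect (adj F) x y.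

(* [cycle] also accepts the closed walk x, y, x along one edge, hence the
   bound 2: only cyclic sequences of at least 3 distinct vertices are cycles. *)
Definition acyclic_graph (T : finType) (F : {set {set T}}) : Prop :=
  forall s : seq T, uniq s -> cycle (adj F) s -> (size s <= 2)%N.

Definition is_tree (T : finType) (V : {set T}) (F : {set {set T}}) : Prop :=
  [/\ is_graph V F, connected_graph V F & acyclic_graph F].

(* An r-edge-colouring of G is a function on all of {set T}, of which only the
   values on the edges of G matter. *)
Definition mono_tree (T : finType) (r : nat) (G : {set {set T}})
    (c : {set T} -> 'I_r) (V : {set T}) (F : {set {set T}}) : Prop :=
  [/\ is_tree V F, F \subset G & forall e f, e \in F -> f \in F -> c e = c f].

Definition mono_tree_coverable (T : finType) (r : nat) (G : {set {set T}})
    (k : nat) : Prop :=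
  forall c : {set T} -> 'I_r,
  exists (V : 'I_k -> {set T}) (F : 'I_k -> {set {set T}}),
    (forall i, mono_tree G c (V i) (F i)) /\ (\bigcup_i V i)%SET = [set: T]%SET.

Lemma mono_tree1 (T : finType) (r : nat) (G : {set {set T}})
    (c : {set T} -> 'I_r) (x : T) : mono_tree G c [set x]%SET set0.
Proof.
split; [split | exact: sub0set | by move=> e f; rewrite inE].
- by move=> e; rewrite inE.
- split; first by apply/set0Pn; exists x; rewrite inE.
  by move=> y z; rewrite !inE => /eqP-> /eqP->.
- case=> [//|y [|z s]] // _ /=.
  by rewrite /adj inE.
Qed.

Lemma mono_tree_coverable_ex (T : finType) (r : nat) (G : {set {set T}}) :
  exists k, `[< mono_tree_coverable r G k >].
Proof.
exists #|T|; apply/asboolP => c.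
exists (fun i => [set enum_val i]%SET), (fun=> set0); split.
  by move=> i; exact: mono_tree1.
apply/setP => x; rewrite inE; apply/bigcupP.
by exists (enum_rank x); rewrite // inE enum_rankK.
Qed.

Definition tc (T : finType) (r : nat) (G : {set {set T}}) : nat :=
  ex_minn (mono_tree_coverable_ex r G).

Lemma tc_leP (T : finType) (r k : nat) (G : {set {set T}}) :
  (0 < #|T|)%N -> (0 < r)%N ->
  (tc r G <= k)%N <-> mono_tree_coverable r G k.
Proof.
move=> /card_gt0P[x0 _] r0; rewrite /tc.
case: ex_minnP => m /asboolP covm minm; split; last first.
  by move=> ?; apply: minm; apply/asboolP.
move=> mk c; have [V [F [VF cov]]] := covm c.
have [i0 _ _] : exists2 i, i \in 'I_m & x0 \in V i.
  have : x0 \in [set: T]%SET by rewrite inE.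
  by rewrite -cov => /bigcupP[i _ ?]; exists i.
pose g (j : 'I_k) : 'I_m := odflt i0 (insub (val j)).
exists (V \o g), (F \o g); split; first by move=> i; exact: VF.
apply/setP => x; rewrite inE; apply/bigcupP.
have : x \in [set: T]%SET by rewrite inE.
rewrite -cov => /bigcupP[i _ xi]; exists (widen_ord mk i) => //=.
by rewrite /g /= insubT //= => ltim; rewrite (_ : Sub _ _ = i) //; exact: val_inj.
Qed.

(* The probability that G(n,p) lies in A: the edge indicators are independent
   Bernoulli(p) variables, so a graph has the product of its edge weights. *)
Definition Gnp_prob (R : realType) (n : nat) (p : R)
    (A : pred {set {set 'I_n}}) : R :=
  \sum_(G in powerset (pairs 'I_n) | A G)
    \prod_(e in pairs 'I_n) (if e \in G then p else 1 - p).

Lemma Gnp_prob_predT (R : realType) n (p : R) : Gnp_prob (n := n) p predT = 1.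
Proof.
rewrite /Gnp_prob.
have h : \prod_(e : {set 'I_n}) ((if e \in pairs 'I_n then p else 0) + (if e \in pairs 'I_n then 1 - p else 1)) = 1 :> R.
  by apply: big1 => e _; case: ifP => _; rewrite ?add0r // addrC subrK.
rewrite -[RHS]h bigA_distr [RHS](bigID (fun G => G \in powerset (pairs 'I_n))) /=.
rewrite [X in _ = _ + X]big1 ?addr0 => [|G].
  apply: eq_big => [G|G]; first by rewrite andbT.
  rewrite andbT powersetE => /subsetP sG; rewrite [LHS]big_mkcond; apply: eq_bigr => e _.
  by case: ifP => // /negP ne; case: ifP => // /sG.
rewrite powersetE => /subsetPn[e eG ne]; rewrite (bigD1 e) //= eG (negPf ne) mul0r //.
Qed.

(* Main.v *)
Require Import Defs.
From mathcomp Require Import all_boot all_order all_algebra.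
From mathcomp Require Import all_classical all_reals all_analysis.
From mathcomp Require Import fintype finset ring lra.
Import Order.TTheory GRing.Theory Num.Theory.
Import numFieldNormedType.Exports.
Set Implicit Arguments.
Unset Strict Implicit.
Unset Printing Implicit Defensive.

(** Suppose that any six vertices of G have a common neighbour, which for this
    [p] holds with high probability by a union bound.  In a 3-edge-colouring
    let [f i x] be the component of [x] in colour [i].  A common neighbour of
    six vertices shares, with each of them, the component of some colour: it
    hits all six in the 3-partite hypergraph with one edge
    [{f 0 x, f 1 x, f 2 x}] per vertex [x].  The point is that such a
    hypergraph has a cover by three components.

    If it had none, then for every three components some vertex would lie
    outside all of them.  Branching over the possible coincidences between the
    components of that vertex and those of the vertices found before, and
    discarding a branch as soon as six vertices in it have no common hit, gives
    a finite search tree; that it closes is checked by computation.  The tree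
    is small because the search first excludes three pairwise disjoint edges,
    and in doing so excludes fourth edges up to the symmetries of the
    configuration. *)

(** * The search *)

(* The pattern of a vertex [x] relative to vertices [x_0, ..., x_(k-1)] has in
   each colour the least [j] with [x] in the component of [x_j], and [k] if [x]
   is in none of these components. *)
Definition pattern := (nat * nat * nat)%type.

Definition coord (p : nat) (a : pattern) : nat :=
  let: (a0, a1, a2) := a in match p with 0 => a0 | 1 => a1 | _ => a2 end.

Definition meets (a b : pattern) : bool :=
  let: (a0, a1, a2) := a in let: (b0, b1, b2) := b in
  [|| a0 == b0, a1 == b1 | a2 == b2].

(* A component of each colour that meets given vertices; [None] marks a colour
   in which the choice is still free. *)
Definition partial_cover := (option nat * option nat * option nat)%type.

Definition agrees (t : option nat) (a : nat) : bool :=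
  if t is Some b then b == a else true.

Definition fits (t : partial_cover) (a : pattern) : bool :=
  let: (t0, t1, t2) := t in let: (a0, a1, a2) := a in
  [&& agrees t0 a0, agrees t1 a1 & agrees t2 a2].

Definition hits (t : partial_cover) (a : pattern) : bool :=
  let: (t0, t1, t2) := t in let: (a0, a1, a2) := a in
  [|| agrees t0 a0, agrees t1 a1 | agrees t2 a2].

Definition complete_cover (t : partial_cover) : bool :=
  if t is (Some _, Some _, Some _) then true else false.

Definition extend1 (e : pattern) (t : partial_cover) : seq partial_cover :=
  let: (t0, t1, t2) := t in let: (a0, a1, a2) := e in
  if [|| t0 == Some a0, t1 == Some a1 | t2 == Some a2] then [:: t] else
  (if t0 is None then [:: (Some a0, t1, t2)] else [::]) ++
  (if t1 is None then [:: (t0, Some a1, t2)] else [::]) ++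
  (if t2 is None then [:: (t0, t1, Some a2)] else [::]).

Definition extend (e : pattern) (cs : seq partial_cover) : seq partial_cover :=
  undup (flatten [seq extend1 e t | t <- cs]).

(* Patterns relative to [k] vertices become patterns relative to [k.+1]: a
   component that was new to [a] may be the one just introduced by [e]. *)
Definition refine1 (k a e : nat) : seq nat :=
  if a < k then [:: a] else if e < k then [:: k.+1] else [:: k.+1; k].

Definition refine (k : nat) (e a : pattern) : seq pattern :=
  let: (e0, e1, e2) := e in let: (a0, a1, a2) := a in
  [seq (b, b2) | b <- [seq (b0, b1) | b0 <- refine1 k a0 e0,
                                      b1 <- refine1 k a1 e1],
                 b2 <- refine1 k a2 e2].

Definition avoids (t : seq (nat * nat)) (a : pattern) : bool :=
  all (fun v => coord v.1 a != v.2) t.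

(** Branches on the first seen vertex still uncovered; once all are covered, the remaining slots are
    filled freely with components of seen vertices. *)
Fixpoint covering_triples (n : nat) (t : seq (nat * nat)) (s : seq pattern) :
    seq (seq (nat * nat)) :=
  if n is n'.+1 then
    let es := if [seq e <- s | avoids t e] is e :: _ then [:: e] else s in
    flatten [seq covering_triples n' ((p, coord p e) :: t) s
                | e <- es, p <- [:: 0; 1; 2]]
  else if has (avoids t) s then [::] else [:: t].

(** A triple covering all seen vertices forces a new vertex; one that leaves few patterns to branch
    on is preferred. If no triple covers them, the default [[::]] excludes nothing. *)
Definition choose (s A : seq pattern) : seq (nat * nat) :=
  (foldl (fun m t => let n := count (avoids t) A in
                     if n < m.2 then (t, n) else m)
         ([::], 1000) (covering_triples 3 [::] s)).1.

Definition matching3 (s : seq pattern) (e : pattern) : bool :=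
  has (fun x => ~~ meets x e &&
                has (fun y => ~~ meets y e && ~~ meets x y) s) s.

(* [covers] lists, for each set of at most four seen vertices, its size and the
   partial covers that meet it. *)
Record state := State {
  seen : seq pattern;
  allowed : seq pattern;
  covers : seq (nat * seq partial_cover) }.

(* [nu2]: no three vertices have pairwise disjoint edges. *)
Definition child (nu2 : bool) (st : state) (e : pattern) : state :=
  let: State s A L := st in
  let L' := [seq (c.1.+1, extend e c.2) | c <- L] in
  let s' := rcons s e in
  let K := [seq c.2 | c <- L' & all complete_cover c.2] in
  State s'
    [seq a <- flatten [seq refine (size s) e a | a <- A] |
       all (has (hits^~ a)) K && ~~ (nu2 && matching3 s' a)]
    (L ++ [seq c <- L' | c.1 < 5]).

Definition drop_patterns (B : seq pattern) (st : state) : state :=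
  State (seen st) [seq a <- allowed st | a \notin B] (covers st).

Definition freshness (k : nat) (e : pattern) : nat :=
  count (fun p => coord p e == k) [:: 0; 1; 2].

(* A pattern is removed from [allowed] once its branch is closed.  Exploring the
   patterns with most new components first keeps the tree small. *)
Fixpoint refute (nu2 : bool) (n : nat) (st : state) : bool :=
  if n is n'.+1 then
    let k := size (seen st) in
    let t := choose (seen st) (allowed st) in
    let es := sort (fun a b => freshness k b <= freshness k a)
                   [seq e <- allowed st | avoids t e] in
    [&& size t <= 3, all (fun v => (v.1 < 3) && (v.2 < k)) t &
    (fix branch es A := if es is e :: es' then
       refute nu2 n' (child nu2 (State (seen st) A (covers st)) e)
         && branch es' (rem e A)
     else true) es (allowed st)]
  else false.

(** Relative to no vertex every pattern is [(0, 0, 0)]; the empty set is met by the cover that is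
    free in all colours. *)
Definition root_state :=
  State [::] [:: (0, 0, 0)] [:: (0, [:: (None, None, None)])].

(** * Soundness of the search *)

Section Names.

Variables T C : eqType.
Implicit Types (f : nat -> T -> C) (xs : seq T) (x y z u w : T).

Definition share f x y :=
  [|| f 0 x == f 0 y, f 1 x == f 1 y | f 2 x == f 2 y].

Definition hit6 f :=
  forall S : seq T, size S <= 6 -> exists w, all (share f w) S.

Definition no_cover3 f :=
  forall v : seq (nat * C), size v <= 3 -> all (fun r => r.1 < 3) v ->
  exists x, all (fun r => f r.1 x != r.2) v.

Definition name f xs x : pattern :=
  (index (f 0 x) (map (f 0) xs), index (f 1 x) (map (f 1) xs),
   index (f 2 x) (map (f 2) xs)).

Lemma coord_name f xs x p : p < 3 ->
  coord p (name f xs x) = index (f p x) (map (f p) xs).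
Proof. by case: p => [|[|[|]]]. Qed.

Lemma share_meets f xs x y : share f x y -> meets (name f xs x) (name f xs y).
Proof.
by rewrite /share /meets /name => /or3P[] /eqP->; rewrite eqxx ?orbT.
Qed.

Lemma index_rcons_refine (g : T -> C) xs x y :
  index (g y) (map g (rcons xs x)) \in
    refine1 (size xs) (index (g y) (map g xs)) (index (g x) (map g xs)).
Proof.
rewrite map_rcons -cats1 index_cat /refine1 -(size_map g) !index_mem.
case: ifP => [yin|ynin]; first by rewrite mem_head.
have [exy|nexy] /= := eqVneq (g x) (g y); last first.
  by rewrite (negPf nexy) addn1; case: ifP; rewrite !inE eqxx.
by rewrite exy eqxx ynin addn0 !inE eqxx orbT.
Qed.

Lemma name_rcons_refine f xs x y :
  name f (rcons xs x) y \in refine (size xs) (name f xs x) (name f xs y).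
Proof.
apply: allpairs_f; last exact: index_rcons_refine.
by apply: allpairs_f; exact: index_rcons_refine.
Qed.

Lemma name_rcons f xs x y : y \in xs ->
  name f (rcons xs x) y = name f xs y.
Proof.
by move=> yxs; rewrite /name !map_rcons -!cats1 !index_cat !map_f.
Qed.

Lemma name_rcons_last f xs x : name f (rcons xs x) x = name f xs x.
Proof.
rewrite /name !map_rcons -!cats1 !index_cat /= !eqxx !addn0.
by do 3![case: ifP => [_|/negbT/memNindex->]].
Qed.

Lemma map_name_rcons f xs x :
  map (name f (rcons xs x)) (rcons xs x) =
    rcons (map (name f xs) xs) (name f xs x).
Proof.
rewrite map_rcons name_rcons_last; congr rcons.
by apply/eq_in_map => y /name_rcons.
Qed.

Definition covering (S : seq pattern) (cs : seq partial_cover) :=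
  forall a, all (meets a) S -> has (fits^~ a) cs.

Lemma extend_covering S cs e :
  covering S cs -> covering (e :: S) (extend e cs).
Proof.
move=> cov a /= /andP[ae /cov/hasP[t tcs ta]].
suff /hasP[t' tt' ta'] : has (fits^~ a) (extend1 e t).
  by apply/hasP; exists t' => //; rewrite mem_undup; apply/flatten_mapP;
    exists t.
case: t e a ae ta {tcs cov} => [[t0 t1] t2] [[e0 e1] e2] [[a0 a1] a2] /=.
case: ifP => [_ _ /=|/negbT]; first by move->.
rewrite !negb_or => nn /or3P[] /eqP ae; move: nn;
  rewrite -ae => /and3P[n0 n1 n2] /and3P[].
- case: t0 n0 => [b nb /= /eqP eb|_ _]; first by rewrite eb eqxx in nb.
  by rewrite /= eqxx /= => -> ->.
- case: t1 n1 => [b nb /= _ /eqP eb|_ /= h0 _ h2];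
    first by rewrite eb eqxx in nb.
  by rewrite has_cat /= eqxx h0 h2 orbT.
- case: t2 n2 => [b nb /= _ _ /eqP eb|_ /= h0 h1 _];
    first by rewrite eb eqxx in nb.
  by rewrite !has_cat /= eqxx h0 h1 !orbT.
Qed.

(** The bound 4 leaves room for six vertices: [child] adds one, and another is the vertex whose
    pattern is tested. *)
Definition valid f xs (st : state) :=
  [/\ seen st = map (name f xs) xs,
      forall x, name f xs x \in allowed st &
      forall c, c \in covers st -> c.1 <= 4 /\
        exists S, [/\ size S = c.1, {subset S <= seen st} & covering S c.2]].

Lemma fits_hits t a b : fits t a -> meets a b -> hits t b.
Proof.
case: t a b => [[t0 t1] t2] [[a0 a1] a2] [[b0 b1] b2] /= /and3P[h0 h1 h2].
by case/or3P => /eqP <-; rewrite ?h0 ?h1 ?h2 ?orbT.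
Qed.

Lemma matching3_name f xs x :
  (forall x y z, [|| share f x y, share f x z | share f y z]) ->
  ~~ matching3 (map (name f xs) xs) (name f xs x).
Proof.
move=> nu2; apply/hasP => -[_ /mapP[y _ ->] /andP[yx]].
case/hasP => [_ /mapP[z _ ->] /andP[zx yz]].
move: yx zx yz; have /or3P[] := nu2 y z x.
- by move/share_meets->.
- by move/share_meets->.
- by move=> /share_meets-> .
Qed.

(** At most five seen vertices together with [y] have a common hit [w]. The pattern of [w] fits a
    recorded partial cover of the seen ones, which therefore hits the pattern of [y]; so no pattern
    that occurs is filtered out. *)
Lemma child_valid (nu2 : bool) f xs x st : hit6 f ->
    (nu2 -> forall x y z, [|| share f x y, share f x z | share f y z]) ->
  valid f xs st -> valid f (rcons xs x) (child nu2 st (name f xs x)).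
Proof.
move=> h6 hnu; case: st => s A L [/= es Aall Lcov].
set L' := [seq _ | c <- L].
have es' : rcons s (name f xs x) = map (name f (rcons xs x)) (rcons xs x).
  by rewrite map_name_rcons es.
have L'cov c : c \in L' -> c.1 <= 5 /\ exists S,
    [/\ size S = c.1, {subset S <= rcons s (name f xs x)} & covering S c.2].
  case/mapP => -[n cs] /Lcov /= [n4 [S [szS sS Scov]]] -> /=; split=> //.
  exists (name f xs x :: S); split;
    [by rewrite /= szS| |exact: extend_covering].
  move=> a; rewrite inE mem_rcons inE => /orP[->//|/sS->].
  by rewrite orbT.
split=> //= [y|c].
  rewrite mem_filter; apply/andP; split; last first.
    apply/flatten_mapP; exists (name f xs y) => //.
    by rewrite es size_map name_rcons_refine.
  apply/andP; split; last first.
    by case: nu2 hnu => // /(_ isT) hnu; rewrite /= es' matching3_name.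
  apply/allP => cs /mapP[c]; rewrite mem_filter => /andP[_ /L'cov] [c5 [S]].
  case=> szS sS Scov ->.
  have [Z [szZ ZS]] : exists Z, size Z = size S /\ S = map (name f (rcons xs
    x)) Z.
    elim: S sS {szS Scov} => [|a S IH] sS; first by exists [::].
    have [|Z [szZ eqS]] := IH; first by move=> b bS; apply: sS;
      rewrite inE bS orbT.
    have := sS a (mem_head _ _); rewrite es' => /mapP[z _ ea].
    by exists (z :: Z); rewrite /= szZ -eqS ea.
  have [|w /= /andP[wy /allP wZ]] := h6 (y :: Z);
    first by rewrite /= szZ szS ltnS.
  have /Scov/hasP[t tc ta] : all (meets (name f (rcons xs x) w)) S.
    by rewrite ZS; apply/allP => _ /mapP[z /wZ wz ->]; exact: share_meets.
  by apply/hasP; exists t => //; apply: fits_hits ta _; exact: share_meets.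
rewrite mem_cat mem_filter => /orP[/Lcov|/andP[c5 /L'cov]] [h [S [szS sS
  Scov]]].
  split=> //; exists S; split=> // a /sS.
  by rewrite mem_rcons inE => ->; rewrite orbT.
by split=> //; exists S.
Qed.

Lemma drop_valid f xs B st : valid f xs st ->
  (forall x, name f xs x \notin B) -> valid f xs (drop_patterns B st).
Proof.
case=> es Aall Lcov nB; split=> //= x.
by rewrite mem_filter nB Aall.
Qed.

(** By [no_cover3] some vertex avoids the triple [t], so its pattern is among the branches [B]; but
    all of these are closed. *)
Lemma refute_sound (nu2 : bool) f n xs st : hit6 f -> no_cover3 f ->
    (nu2 -> forall x y z, [|| share f x y, share f x z | share f y z]) ->
  valid f xs st -> refute nu2 n st -> False.
Proof.
move=> h6 nc3 hnu; elim: n xs st => // n IH xs st [es Aall Lcov] /=.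
set t := choose _ _; set B := sort _ _; set br := (X in X B).
case/and3P=> t3 tk brB.
(* Once the branch of [e] is closed, no vertex has pattern [e], so removing [e] keeps the state
   valid for the later branches. *)
have nB x : name f xs x \notin B.
  have : valid f xs (State (seen st) (allowed st) (covers st)) by split.
  move: brB; elim: B (allowed st) x => // e B IHB A x /= /andP[re rB] vA.
  have ne y : name f xs y != e.
    apply/eqP => ye; apply: (IH (rcons xs y) _ _ re); rewrite -ye;
      exact: (child_valid y h6 hnu vA).
  rewrite inE negb_or ne /=; apply: IHB rB _.
  case: vA => /= ? Aall' ?; split=> //= y.
  have := Aall' y; move: (ne y); elim: (A) => //= b A' IHA nye.
  rewrite inE; have [->|_] := eqVneq b e; first by rewrite (negPf nye).
  by rewrite inE => /orP[->//|/(IHA nye)->]; rewrite orbT.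
have [x0 _] := nc3 [::] isT isT.
have [||x /allP xt] := nc3 [seq (v.1, f v.1 (nth x0 xs v.2)) | v <- t].
- by rewrite size_map.
- by rewrite all_map; apply: sub_all tk => v /andP[].
have /negP := nB x; apply; rewrite mem_sort mem_filter Aall andbT.
apply/allP => v vt; have /andP[v3 vk] := allP tk _ vt; rewrite coord_name //.
have /= := xt _ (map_f _ vt); apply: contra => /eqP iv.
move: vk; rewrite es size_map -iv => vk.
by rewrite -(nth_map x0 (f v.1 x0)) // nth_index // -index_mem size_map.
Qed.

Lemma valid_root_state f : valid f [::] root_state.
Proof.
split=> // c; rewrite inE => /eqP-> /=; split=> //; exists [::]; split=> //.
by case=> [[a0 a1] a2].
Qed.

(** * Excluding three pairwise disjoint edges *)

Definition matching_state :=
  foldl (child false) root_state [:: (0, 0, 0); (1, 1, 1); (2, 2, 2)].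

Definition disjoint3 f x y z :=
  [&& ~~ share f x y, ~~ share f x z & ~~ share f y z].

Lemma valid_matching_state f x y z : hit6 f -> disjoint3 f x y z ->
  valid f [:: x; y; z] matching_state.
Proof.
move=> h6 /and3P[]; rewrite /share !negb_or.
move=> /and3P[/negPf xy0 /negPf xy1 /negPf xy2].
move=> /and3P[/negPf xz0 /negPf xz1 /negPf xz2].
move=> /and3P[/negPf yz0 /negPf yz1 /negPf yz2].
have nf : false -> forall a b c, [|| share f a b,
  share f a c | share f b c] by [].
have v1 : valid f [:: x] (child false root_state (0, 0, 0)).
  exact: (child_valid x h6 nf (valid_root_state f)).
have v2 : valid f [:: x; y] (child false (child false root_state (0, 0,
  0)) (1, 1, 1)).
  have <- : name f [:: x] y = (1, 1, 1) by rewrite /name /= xy0 xy1 xy2.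
  exact: (child_valid y h6 nf v1).
pose st := child false (child false root_state (0, 0, 0)) (1, 1, 1).
rewrite -[matching_state]/(child false st (2, 2, 2)).
have <- : name f [:: x; y] z = (2, 2, 2).
  by rewrite /name /= xz0 xz1 xz2 yz0 yz1 yz2.
exact: child_valid nf v2.
Qed.

(* Three pairwise disjoint edges have patterns (0,0,0), (1,1,1), (2,2,2); a
   fourth vertex has coordinates at most 3. *)
Definition forbidden (e : pattern) := forall f x y z u, hit6 f -> no_cover3 f ->
  disjoint3 f x y z -> name f [:: x; y; z] u != e.

(** Patterns already forbidden may be dropped at the start, since no vertex has them; 16 bounds the
    depth of the search. *)
Lemma forbidden_refute B e : {in B, forall a, forbidden a} ->
  refute false 16 (child false (drop_patterns B matching_state) e) ->
    forbidden e.
Proof.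
move=> fB re f x y z u h6 nc xyz; apply/eqP => eu.
apply: (@refute_sound false f 16 (rcons [:: x; y; z] u) _ h6 nc _ _ re) => //.
rewrite -eu; apply: child_valid => //.
apply: drop_valid; first exact: valid_matching_state.
by move=> v; apply/negP => /fB/(_ f x y z v h6 nc xyz)/eqP.
Qed.

(** Both transpositions serve two symmetries: [relabel] permutes the three disjoint edges, fixing
    the index 3 of a new component, and [permute] permutes the colours. *)
Definition swap01 (p : nat) := match p with 0 => 1 | 1 => 0 | _ => p end.
Definition swap12 (p : nat) := match p with 1 => 2 | 2 => 1 | _ => p end.

Definition relabel (s : nat -> nat) (e : pattern) : pattern :=
  let: (e0, e1, e2) := e in (s e0, s e1, s e2).
Definition permute (s : nat -> nat) (e : pattern) : pattern :=
  (coord (s 0) e, coord (s 1) e, coord (s 2) e).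

Lemma index_swap01 (a b c d : C) : a != b ->
  index d [:: b; a; c] = swap01 (index d [:: a; b; c]).
Proof.
move=> ab /=; have [ad|ad] := eqVneq a d; have [bd|bd] := eqVneq b d => //.
by rewrite ad bd eqxx in ab.
Qed.

Lemma index_swap12 (a b c d : C) : b != c ->
  index d [:: a; c; b] = swap12 (index d [:: a; b; c]).
Proof.
move=> bc /=; case: ifP => // _.
by have [bd|bd] := eqVneq b d; have [cd|cd] := eqVneq c d => //;
  rewrite bd cd eqxx in bc.
Qed.

Lemma share_sym f x y : share f x y = share f y x.
Proof. by rewrite /share !(eq_sym (f _ x)). Qed.

(** Exchanging [x] and [y] keeps the hypotheses and swaps the indices 0 and 1, the components of [x]
    and [y] being distinct in each colour. *)
Lemma forbidden_relabel01 e : forbidden (relabel swap01 e) -> forbidden e.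
Proof.
move=> fe f x y z u h6 nc xyz; move: (xyz) => /and3P[xy xz yz].
have yxz : disjoint3 f y x z by rewrite /disjoint3 share_sym xy yz xz.
have /negP := fe f y x z u h6 nc yxz; apply: contra_notN => /eqP<- /=.
move: xy; rewrite /share !negb_or => /and3P[n0 n1 n2].
by apply/eqP; congr (_, _, _); apply: index_swap01.
Qed.

Lemma forbidden_relabel12 e : forbidden (relabel swap12 e) -> forbidden e.
Proof.
move=> fe f x y z u h6 nc xyz; move: (xyz) => /and3P[xy xz yz].
have xzy : disjoint3 f x z y by rewrite /disjoint3 (share_sym f z) xy yz xz.
have /negP := fe f x z y u h6 nc xzy; apply: contra_notN => /eqP<- /=.
move: yz; rewrite /share !negb_or => /and3P[n0 n1 n2].
by apply/eqP; congr (_, _, _); apply: index_swap12.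
Qed.

(** The hypotheses are also symmetric in the colours, so they pass from [f] to [f \o s]. *)
Lemma forbidden_perm s e : (forall p, (s p < 3) = (p < 3)) -> involutive s ->
    (forall f x y, share (f \o s) x y = share f x y) ->
  forbidden (permute s e) -> forbidden e.
Proof.
move=> s3 sK sh fe f x y z u h6 nc xyz.
have h6' : hit6 (f \o s).
  by move=> S /h6[w wS]; exists w; rewrite (eq_all (sh f w)).
have nc' : no_cover3 (f \o s).
  move=> v sz v3; have [||w wv] := nc [seq (s r.1, r.2) | r <- v].
  - by rewrite size_map.
  - by rewrite all_map (eq_all (fun r => s3 r.1)).
  by exists w; rewrite all_map in wv.
have xyz' : disjoint3 (f \o s) x y z by rewrite /disjoint3 !sh.
have /negP := fe _ x y z u h6' nc' xyz'; apply: contra_notN => /eqP<-.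
by rewrite /permute !coord_name ?s3.
Qed.

Lemma forbidden_perm01 e : forbidden (permute swap01 e) -> forbidden e.
Proof.
apply: forbidden_perm => [[|[|[]]]|[|[|]]|f x y] //.
by rewrite /share /= orbCA.
Qed.

Lemma forbidden_perm12 e : forbidden (permute swap12 e) -> forbidden e.
Proof.
apply: forbidden_perm => [[|[|[]]]|[|[|[]]]|f x y] //.
by rewrite /share /=; congr (_ || _); rewrite orbC.
Qed.

(** Five rounds reach the whole orbit of each pattern used below: two adjacent colour swaps place
    the odd coordinate, and at most three index swaps do the rest. *)
Definition orbit_step (l : seq pattern) : seq pattern :=
  undup (l ++ map (permute swap01) l ++ map (permute swap12) l ++
         map (relabel swap01) l ++ map (relabel swap12) l).
Definition pattern_orbit (e : pattern) := iter 5 orbit_step [:: e].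

Lemma relabel_involutive s : involutive s -> involutive (relabel s).
Proof. by move=> sK [[a b] c] /=; rewrite !sK. Qed.

Lemma forbidden_orbit e : forbidden e -> {in pattern_orbit e, forall a,
  forbidden a}.
Proof.
move=> fe; rewrite /pattern_orbit; elim: 5 => [a|n IH];
  first by rewrite inE => /eqP->.
move=> a; rewrite iterS mem_undup !mem_cat; case/or4P => [/IH //|||].
- case/mapP => b /IH fb ->; apply: forbidden_perm01; case: b fb => [[? ?] ?] //.
- case/mapP => b /IH fb ->; apply: forbidden_perm12; case: b fb => [[? ?] ?] //.
case/orP => /mapP[b /IH fb ->].
  by apply: forbidden_relabel01; rewrite relabel_involutive // => -[|[]].
by apply: forbidden_relabel12; rewrite relabel_involutive // => -[|[|[]]].
Qed.

(** Fourth edges with two new components go first, then those with one. The pattern [(3, 3, 3)] is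
    never allowed: a common hit of [x], [y], [z] spends all three colours on them. *)
Lemma refute_033 : refute false 16
  (child false (drop_patterns [::] matching_state) (0, 3, 3)).
Proof. by vm_compute. Qed.

Lemma refute_301 : refute false 16
  (child false (drop_patterns (pattern_orbit (0, 3, 3)) matching_state) (3, 0,
    1)).
Proof. by vm_compute. Qed.

Lemma refute_300 : refute false 16
  (child false (drop_patterns (pattern_orbit (0, 3, 3) ++ pattern_orbit (3, 0,
    1)) matching_state)
     (3, 0, 0)).
Proof. by vm_compute. Qed.

(** Only fourth edges inside the components of the three disjoint edges remain at the start. *)
Lemma refute_matching : refute false 16
  (drop_patterns (pattern_orbit (0, 3, 3) ++ pattern_orbit (3, 0,
    1) ++ pattern_orbit (3, 0, 0))
     matching_state).
Proof. by vm_compute. Qed.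

Lemma refute_no_matching : refute true 16 (child true root_state (0, 0, 0)).
Proof. by vm_compute. Qed.

Lemma forbidden_033 : forbidden (0, 3, 3).
Proof. by apply: forbidden_refute refute_033. Qed.

Lemma forbidden_301 : forbidden (3, 0, 1).
Proof.
apply: forbidden_refute refute_301.
exact: (forbidden_orbit forbidden_033).
Qed.

Lemma forbidden_cat A B :
    {in A, forall a, forbidden a} -> {in B, forall a, forbidden a} ->
  {in A ++ B, forall a, forbidden a}.
Proof. by move=> fA fB a; rewrite mem_cat => /orP[/fA|/fB]. Qed.

Lemma forbidden_300 : forbidden (3, 0, 0).
Proof.
apply: forbidden_refute refute_300.
apply: forbidden_cat; first exact: (forbidden_orbit forbidden_033).
exact: (forbidden_orbit forbidden_301).
Qed.

Lemma no_disjoint3 f x y z : hit6 f -> no_cover3 f -> ~~ disjoint3 f x y z.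
Proof.
move=> h6 nc; apply/negP => xyz.
have nf : false -> forall a b c, [|| share f a b,
  share f a c | share f b c] by [].
apply: (refute_sound h6 nc nf _ refute_matching).
apply: drop_valid (valid_matching_state h6 xyz) _ => u.
have fB := forbidden_cat (forbidden_orbit forbidden_033)
  (forbidden_cat (forbidden_orbit forbidden_301) (forbidden_orbit
    forbidden_300)).
by apply/negP => /fB/(_ f x y z u h6 nc xyz)/eqP.
Qed.

Theorem hit6_cover3 f : hit6 f -> ~ no_cover3 f.
Proof.
move=> h6 nc; have [x _] := nc [::] isT isT.
have nm : true -> forall a b c, [|| share f a b, share f a c | share f b c].
  by move=> _ a b c; have := no_disjoint3 a b c h6 nc; rewrite !negb_and !negbK.
apply: (refute_sound h6 nc nm _ refute_no_matching).
exact: (child_valid x h6 nm (valid_root_state f)).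
Qed.

End Names.

(** * Monochromatic spanning trees *)

Section SpanningTrees.

Variable T : finType.
Implicit Types (V : {set T}) (E F : {set {set T}}) (u v x y : T).

Lemma adj_sym F : symmetric (adj F).
Proof. by move=> x y; rewrite /adj setUC. Qed.

Lemma adj_connect_sym F : connect_sym (adj F).
Proof. exact/sym_connect_sym/adj_sym. Qed.

Lemma graph_adj_mem V F x y : is_graph V F -> adj F x y -> x \in V.
Proof.
by move=> gF /gF[_ /subsetP]; apply; rewrite !inE eqxx.
Qed.

(** In a cycle through [v] both neighbours of [v] would be [u]; a cycle avoiding [v] lies in the old
    tree. *)
Lemma tree_add_leaf V F u v : is_tree V F -> u \in V -> v \notin V ->
  is_tree (v |: V) ([set u; v] |: F).
Proof.
move=> [gF [V0 cF] aF] uV vV.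
have neuv : u != v by apply: contraNneq vV => <-.
have adjv a : adj ([set u; v] |: F) v a -> a != v -> a = u.
  move=> + av; rewrite /adj !inE => /orP[/eqP eva|/(graph_adj_mem gF)];
    last first.
    by rewrite (negPf vV).
  have : a \in [set u; v] by rewrite -eva !inE eqxx orbT.
  by rewrite !inE (negPf av) orbF => /eqP.
split.
- move=> e; rewrite !inE => /orP[/eqP->|/gF[]].
    split; first by rewrite cards2 neuv.
    by apply/subsetP => z; rewrite !inE => /orP[]/eqP->;
      rewrite ?uV ?eqxx ?orbT.
  by rewrite inE => e2 eV; split=> //; apply: subset_trans eV (subsetUr _ _).
- split; first by apply/set0Pn; exists v; rewrite !inE eqxx.
  have cu z : z \in v |: V -> connect (adj ([set u; v] |: F)) u z.
    rewrite !inE => /orP[/eqP->|zV].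
      by apply: connect1; rewrite /adj !inE eqxx.
    apply: connect_sub (cF _ _ uV zV) => a b ab.
    by apply: connect1; move: ab; rewrite /adj !inE => ->; rewrite orbT.
  move=> a b /cu ua /cu; apply: connect_trans.
  by rewrite adj_connect_sym.
- move=> s us cs; have [vs|vs] := boolP (v \in s); last first.
    have sub : {in predC1 v &, subrel (adj ([set u; v] |: F)) (adj F)}.
      move=> a b; rewrite !inE => av bv; rewrite /adj !inE => /orP[/eqP e|//].
      have : v \in [set a; b] by rewrite e !inE eqxx orbT.
      by rewrite !inE eq_sym (negPf av) eq_sym (negPf bv).
    apply: aF => //; apply: sub_in_cycle sub _ _ cs.
    by apply/allP => z zs; apply: contraNneq vs => <-.
  have [i s' si] := rot_to vs; move: us cs;
    rewrite -(rot_uniq i) -(rot_cycle i) si.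
  rewrite -(size_rot i) si {si}; case: s' => [//|a [//|b q]].
  rewrite [uniq _]/= => /and3P[vn an _];
    rewrite (cycle_path v) /= => /and4P[lv va _ _].
  have ea : a = u.
    by apply: adjv va _; apply: contraNneq vn => <-; rewrite mem_head.
  have lq : last b q \in b :: q by rewrite mem_last.
  have el : last b q = u.
    apply: adjv; first by rewrite adj_sym.
    by apply: contraNneq vn => <-; rewrite inE lq orbT.
  by move: an; rewrite ea -el lq.
Qed.

(** While the tree does not fill the component, some edge leaves it and adds a leaf; the size of the
    component bounds this growth. *)
Lemma spanning_tree E x : E \subset pairs T ->
  exists2 F : {set {set T}}, F \subset E &
    is_tree [set y | connect (adj E) x y] F.
Proof.
move=> Epairs; pose K := [set y | connect (adj E) x y].
have grow n : exists (V : {set T}) (F : {set {set T}}), [/\ is_tree V F,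
  F \subset E, x \in V, V \subset K
    & K \subset V \/ n <= #|V|].
  elim: n => [|n [V [F [tV FE xV VK]]]].
    exists [set x], set0; split; [|exact: sub0set|exact: set11| |by right].
      by case: (mono_tree1 set0 (fun=> ord0 : 'I_1) x).
    by rewrite sub1set inE.
  have [KV _|KV [//|nV]] := boolP (K \subset V); first by exists V, F;
    split=> //; left.
  have /exists_inP[u uV /exists_inP[v vV uv]] :
      [exists u in V, exists v in ~: V, adj E u v].
    apply: contraNT KV => noex; apply/subsetP => y; rewrite inE => xy.
    rewrite -(closed_connect _ xy) //; apply: intro_closed.
      exact: adj_connect_sym.
    move=> a b ab aV; apply: contraNT noex => bV.
    by apply/exists_inP; exists a => //; apply/exists_inP; exists b;
      rewrite ?inE.
  rewrite inE in vV; exists (v |: V), ([set u; v] |: F); split.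
  - exact: tree_add_leaf.
  - by rewrite subUset sub1set FE andbT; exact: uv.
  - by rewrite !inE xV orbT.
  - rewrite subUset VK andbT sub1set inE.
    have := subsetP VK _ uV; rewrite inE => /connect_trans; apply.
    exact: connect1.
  - by right; rewrite cardsU1 vV.
have [V [F [tV FE xV VK]]] := grow #|K|.+1.
case=> [KV|/leq_trans/(_ (subset_leq_card VK))]; last by rewrite ltnn.
by exists F => //; rewrite -/K (_ : K = V) //; apply/eqP; rewrite eqEsubset KV.
Qed.

End SpanningTrees.


(** Components are encoded by canonical representatives; the three components of the cover are
    replaced by spanning trees. *)
Lemma common_neighbour_coverable (T : finType) (G : {set {set T}}) :
    G \subset pairs T ->
    (forall S : seq T, size S <= 6 ->
       exists w, all (fun x => [set w; x] \in G) S) ->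
  mono_tree_coverable 3 G 3.
Proof.
move=> Gpairs nbr c; have [x0 _] := nbr [::] isT.
pose E i := [set e in G | c e == i].
have Epairs i : E i \subset pairs T.
  by apply: subset_trans Gpairs; apply/subsetP => e; rewrite inE => /andP[].
pose f p := fingraph.root (adj (E (inord p : 'I_3))).
have fP p x y : f p x = f p y <-> connect (adj (E (inord p))) x y.
  by split=> /(fingraph.rootP (adj_connect_sym _)).
have h6 : hit6 f.
  move=> S /nbr[w wS]; exists w; apply: sub_all wS => x wx.
  suff : f (c [set w; x]) w == f (c [set w; x]) x.
    rewrite /share; move: (c _) => -[[|[|[|//]]] ?] /= ->; by rewrite ?orbT.
  by apply/eqP/fP/connect1; rewrite /adj inE wx inord_val eqxx.
have /existsNP[v /not_implyP[v3 /not_implyP[vp /forallNP cov]]] :=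
  hit6_cover3 h6.
have comp (r : nat * T) : exists VF : {set T} * {set {set T}},
    mono_tree G c VF.1 VF.2 /\ (forall x, f r.1 x = r.2 -> x \in VF.1).
  (* A pair that names no component gets a one-vertex tree. *)
  have [[x fx]|nox] := pselect (exists x, f r.1 x = r.2); last first.
    exists ([set x0], set0); split; first exact: mono_tree1.
    by move=> x fx; case: nox; exists x.
  have [F FE tF] := spanning_tree x (Epairs (inord r.1)).
  exists ([set y | connect (adj (E (inord r.1))) x y], F); split=> /= [|y fy].
    split=> //; first by apply: subset_trans FE _; apply/subsetP => e;
      rewrite inE => /andP[].
    move=> e e' /(subsetP FE) + /(subsetP FE); rewrite !inE.
    by move=> /andP[_ /eqP->] /andP[_ /eqP->].
  by rewrite inE; apply/fP; rewrite fx fy.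
have [VF VFP] := choice comp.
(* The cover [v] may have fewer than three entries; the default [(0, x0)] supplies the missing
   trees. *)
exists (fun i => (VF (nth (0, x0) v i)).1), (fun i => (VF (nth (0, x0) v i)).2).
split=> [i|]; first by have [] := VFP (nth (0, x0) v i).
apply/setP => x; rewrite inE; apply/bigcupP.
have /negP := cov x; rewrite -has_predC => /hasP[r rv /negPn/eqP fr].
have iv : index r v < 3 by apply: leq_trans v3; rewrite index_mem.
exists (Ordinal iv) => //=; rewrite nth_index //.
by have [_] := VFP r; apply.
Qed.

Local Open Scope ring_scope.

(** * Common neighbours in the random graph *)

Lemma big_powerset_prod (R : comPzRingType) (I : finType) (A : {set I})
    (F G : I -> R) :
  \prod_(i in A) (F i + G i) =
    \sum_(J in powerset A) \prod_(i in A) (if i \in J then F i else G i).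
Proof.
rewrite big_mkcond /=.
rewrite (eq_bigr (fun i => (if i \in A then F i else 0) +
                           (if i \in A then G i else 1))); last first.
  by move=> i _; case: ifP; rewrite ?add0r.
rewrite bigA_distr (bigID (mem (powerset A))) /= [X in _ + X]big1 ?addr0.
  apply: eq_bigr => J; rewrite powersetE => /subsetP sJ.
  rewrite [RHS]big_mkcond; apply: eq_bigr => i _.
  by case: ifP => [/sJ->//|_]; case: ifP.
move=> J; rewrite powersetE => /subsetPn[i iJ iA].
by rewrite (bigD1 i) //= iJ (negPf iA) mul0r.
Qed.

Section RandomGraph.

Variables (R : realType) (n : nat) (p : R).
Local Notation T := 'I_n.
Implicit Types (G D : {set {set T}}) (S W : {set T}) (w x : T).

Definition Gnp_weight G : R :=
  \prod_(e in pairs T) (if e \in G then p else 1 - p).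

(** Giving the absence of an edge of [D] weight 0 absorbs the indicator, and the sum factors over
    the pairs. *)
Lemma Gnp_contains D : D \subset pairs T ->
  \sum_(G in powerset (pairs T)) Gnp_weight G * (D \subset G)%:R = p ^+ #|D|.
Proof.
move=> Dp; pose b e : R := if e \in D then 0 else 1 - p.
transitivity (\sum_(G in powerset (pairs T))
    \prod_(e in pairs T) (if e \in G then p else b e)).
  apply: eq_bigr => G _; have [DG|/subsetPn[e eD eG]] := boolP (D \subset G).
    rewrite mulr1; apply: eq_bigr => e _; rewrite /b.
    by case: ifP => // eG; case: ifP => // /(subsetP DG); rewrite eG.
  rewrite mulr0 (bigD1 e) ?(subsetP Dp) //= (negPf eG) /b eD.
  by rewrite mul0r.
rewrite -big_powerset_prod (bigID (mem D)) /= [X in _ * X]big1 ?mulr1.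
  rewrite -[RHS]prodr_const; apply: eq_big => [e|e /andP[_ eD]].
    by apply: andb_idl => /(subsetP Dp).
  by rewrite /b eD addr0.
by move=> e /andP[_ eD]; rewrite /b (negPf eD) addrC subrK.
Qed.

Definition star S w : {set {set T}} := [set [set w; x] | x in S].

Definition no_common_neighbour S G :=
  [forall w in ~: S, ~~ (star S w \subset G)].

(** An edge determines its end in [S] and its end in [W], as these sets are disjoint. *)
Lemma card_stars S W : W \subset ~: S ->
  #|\bigcup_(w in W) star S w| = (#|W| * #|S|)%N.
Proof.
move=> WS; rewrite -cardsX -(card_in_imset (f := fun u : T * T => [set u.1;
  u.2])).
  congr #|pred_of_set _|; apply/setP => e; apply/bigcupP/imsetP.
    by move=> [w wW /imsetP[x xS ->]]; exists (w, x); rewrite ?inE ?wW.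
  by move=> [[w x]]; rewrite !inE /= => /andP[wW xS] ->; exists w => //;
    apply: imset_f.
have disj w x : w \in W -> x \in S -> w != x.
  by move=> /(subsetP WS); rewrite inE => wS xS; apply: contraNneq wS => ->.
move=> [w x] [w' x']; rewrite !inE /= => /andP[wW xS] /andP[wW' xS'] e.
have : w \in [set w'; x'] by rewrite -e !inE eqxx.
have : x \in [set w'; x'] by rewrite -e !inE eqxx orbT.
rewrite !inE (negPf (disj _ _ wW xS')) orbF eq_sym (negPf (disj _ _ wW' xS)) /=.
by move=> /eqP-> /eqP->.
Qed.

Lemma stars_pairs S W : W \subset ~: S ->
  \bigcup_(w in W) star S w \subset pairs T.
Proof.
move=> WS; apply/bigcupsP => w wW; apply/subsetP => e /imsetP[x xS ->].
have wx : w != x by apply: contraTneq (subsetP WS _ wW) => ->; rewrite inE xS.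
by rewrite inE cards2 wx.
Qed.

(* Expanding the product over [w] of the indicators that [w] is not a common
   neighbour reduces the claim to the probabilities that given edges occur. *)
Lemma Gnp_no_common_neighbour S :
  \sum_(G in powerset (pairs T)) Gnp_weight G * (no_common_neighbour S G)%:R =
    (1 - p ^+ #|S|) ^+ #|~: S|.
Proof.
have indE G : (no_common_neighbour S G)%:R =
    \sum_(W in powerset (~: S))
      (-1) ^+ #|W| * (\bigcup_(w in W) star S w \subset G)%:R :> R.
  transitivity (\prod_(w in ~: S) (- (star S w \subset G)%:R + 1) : R).
    have [/forall_inP nG|/forall_inPn[w wS /negPn wG]] :=
      boolP (no_common_neighbour S G).
      by rewrite big1 // => w /nG/negPf->; rewrite oppr0 add0r.
    by rewrite (bigD1 w) //= wG addNr mul0r.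
  rewrite big_powerset_prod; apply: eq_bigr => W; rewrite powersetE => WS.
  rewrite (bigID (mem W)) /= [X in _ * X]big1 ?mulr1; last first.
    by move=> w /andP[_ /negPf->].
  rewrite (eq_bigl (fun w => w \in W)); last first.
    by move=> w /=; apply: andb_idl => /(subsetP WS).
  rewrite (eq_bigr (fun w => (-1) * (star S w \subset G)%:R)); last first.
    by move=> w ->; rewrite mulN1r.
  rewrite big_split /= prodr_const; congr (_ * _).
  have [WG|/forall_inPn[w wW wG]] := boolP [forall w in W, star S w \subset G].
    rewrite big1 => [|w wW]; last by rewrite (forall_inP WG).
    by rewrite (introT bigcupsP) // => w; apply: (forall_inP WG).
  rewrite (bigD1 w) //= (negPf wG) mul0r.
  by case: bigcupsP => // /(_ w wW) wG'; rewrite wG' in wG.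
under eq_bigr => G _ do rewrite indE mulr_sumr.
rewrite exchange_big /=.
(* The stars being edge-disjoint, each [W] contributes a product over its elements, and the sum
   folds back into a product over [w]. *)
transitivity (\sum_(W in powerset (~: S)) \prod_(w in ~: S)
     (if w \in W then - p ^+ #|S| else 1)); last first.
  rewrite -big_powerset_prod (eq_bigr (fun=> 1 - p ^+ #|S|)) ?prodr_const //.
  by move=> w _; rewrite addrC.
apply: eq_bigr => W; rewrite powersetE => WS.
under eq_bigr => G _ do rewrite mulrCA.
rewrite -mulr_sumr Gnp_contains ?stars_pairs // card_stars //.
rewrite mulnC exprM -exprMn mulN1r -(prodr_const (mem W)).
rewrite [RHS](bigID (mem W)) /= [X in _ = _ * X]big1 ?mulr1; last first.
  by move=> w /andP[_ /negPf->].
apply: eq_big => [w|w ->] //=.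
by apply/esym/andb_idl => /(subsetP WS).
Qed.

Hypothesis p01 : 0 <= p <= 1.

Lemma Gnp_weight_ge0 G : 0 <= Gnp_weight G.
Proof.
by case/andP: p01 => p0 p1; apply: prodr_ge0 => e _; case: ifP;
  rewrite ?subr_ge0.
Qed.

Lemma Gnp_probE (A : pred {set {set T}}) :
  Gnp_prob p A = \sum_(G in powerset (pairs T)) Gnp_weight G * (A G)%:R.
Proof.
rewrite /Gnp_prob big_mkcondr; apply: eq_bigr => G _.
by case: (A G); rewrite ?mulr1 ?mulr0.
Qed.

Lemma Gnp_prob_le1 (A : pred {set {set T}}) : Gnp_prob p A <= 1.
Proof.
rewrite -(Gnp_prob_predT n p) !Gnp_probE; apply: ler_sum => G _.
by rewrite ler_wpM2l ?Gnp_weight_ge0 // ler_nat; case: (A G).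
Qed.

(** A union bound over the [n ^ k] tuples. Repeated entries only make the set smaller, which lowers
    the failure probability. *)
Lemma Gnp_prob_ge_common_neighbour (k : nat) (A : pred {set {set T}}) :
    (forall G, G \subset pairs T -> ~~ A G ->
      exists t : k.-tuple T, no_common_neighbour [set x in t] G) ->
  1 - n%:R ^+ k * (1 - p ^+ k) ^+ (n - k) <= Gnp_prob p A.
Proof.
move=> badA; case/andP: (p01) => p0 p1.
rewrite lerBlDr -{1}(Gnp_prob_predT n p) !Gnp_probE.
apply: (@le_trans _ _ (\sum_(G in powerset (pairs T)) Gnp_weight G * (A G)%:R +
   \sum_(t : k.-tuple T) \sum_(G in powerset (pairs T))
      Gnp_weight G * (no_common_neighbour [set x in t] G)%:R)).
  rewrite exchange_big -big_split /=; apply: ler_sum => G.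
  rewrite powersetE => Gp; rewrite -mulr_sumr -mulrDr.
  rewrite ler_wpM2l ?Gnp_weight_ge0 //.
  have [AG|/(badA _ Gp)[t tG]] := boolP (A G).
    by rewrite lerDl sumr_ge0.
  by rewrite add0r (bigD1 t) //= tG lerDl sumr_ge0.
rewrite lerD2l -natrX -[X in (X ^ k)%N]card_ord -card_tuple mulr_natl
  -sumr_const.
apply: ler_sum => t _; rewrite Gnp_no_common_neighbour.
have tk : (#|[set x in t]| <= k)%N.
  by rewrite cardsE; apply: leq_trans (card_size t) _; rewrite size_tuple.
have h1 m : 0 <= 1 - p ^+ m <= 1.
  by rewrite subr_ge0 exprn_ile1 //= gerBl exprn_ge0.
apply: (@le_trans _ _ ((1 - p ^+ k) ^+ #|~: [set x in t]|)).
  have [/andP[h _] /andP[h' _]] := (h1 #|[set x in t]|, h1 k).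
  by apply: lerXn2r; rewrite ?nnegrE // lerD2l lerN2 ler_wiXn2l.
have /andP[? ?] := h1 k.
by rewrite ler_wiXn2l // cardsCs setCK card_ord leq_sub2l.
Qed.

End RandomGraph.

(** The factor 2 gives 64 in the sixth power, and [n - 6 >= n / 2] leaves [32 * L]. Only [7 * L] is
    kept: six powers of [n] offset the union bound and one remains. *)
Lemma missing_neighbour_bound (R : realType) (n : nat) (p : R) : (12 <= n)%N ->
  0 <= p <= 1 -> 2 <= p / (ln (n%:R : R) / n%:R) `^ (6%:R^-1) ->
  n%:R ^+ 6 * (1 - p ^+ 6) ^+ (n - 6) <= n%:R^-1.
Proof.
move=> n12 /andP[p0 p1]; set L := ln _; set q := _ `^ _ => pq.
have n0 : 0 < n%:R :> R by rewrite ltr0n (leq_trans _ n12).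
have L0 : 0 < L by rewrite ln_gt0 // ltr1n (leq_trans _ n12).
have Ln0 : 0 < L / n%:R by rewrite divr_gt0.
have q0 : 0 < q by rewrite powR_gt0.
have q6 : q ^+ 6 = L / n%:R.
  by rewrite -powR_mulrn ?powR_ge0 // -powRrM mulVf ?pnatr_eq0 // powRr1 // ltW.
have p6 : 64 * (L / n%:R) <= p ^+ 6.
  rewrite -q6; have -> : 64 * q ^+ 6 = (2 * q) ^+ 6 by ring.
  apply: lerXn2r; rewrite ?nnegrE ?mulr_ge0 // ?(ltW q0) //.
  by rewrite -ler_pdivlMr.
have n6 : n%:R / 2 <= (n - 6)%:R :> R.
  rewrite natrB ?(leq_trans _ n12) //.
  have : 12 <= n%:R :> R by rewrite ler_nat.
  lra.
have pn : 7 * L <= p ^+ 6 * (n - 6)%:R.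
  apply: (@le_trans _ _ (64 * (L / n%:R) * (n%:R / 2))).
    have -> : 64 * (L / n%:R) * (n%:R / 2) = 32 * L by field; rewrite gt_eqF.
    by rewrite ler_wpM2r ?(ltW L0) // ler_nat.
  by rewrite ler_pM // ?mulr_ge0 ?(ltW Ln0) // ?divr_ge0 // ltW.
have p61 : 0 <= 1 - p ^+ 6 by rewrite subr_ge0 exprn_ile1.
have e7 : (1 - p ^+ 6) ^+ (n - 6) <= (n%:R ^+ 7)^-1.
  apply: (@le_trans _ _ (expR (- p ^+ 6) ^+ (n - 6))).
    by apply: lerXn2r; rewrite ?nnegrE ?expR_ge0 // expR_ge1Dx.
  rewrite -expRM_natr -[n%:R ^+ 7](_ : expR (7 * L) = _); last first.
    by rewrite expRM_natl lnK ?posrE.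
  by rewrite -expRN ler_expR mulNr lerN2.
apply: (@le_trans _ _ (n%:R ^+ 6 * (n%:R ^+ 7)^-1)).
  by apply: ler_wpM2l e7; rewrite exprn_ge0 // ltW.
by rewrite (exprS _ 6) invfM mulrCA mulfV ?mulr1 // expf_eq0 gt_eqF.
Qed.

Local Open Scope classical_set_scope.

Theorem theorem1p1 (R : realType) (p : nat -> R) :
  (forall n : nat, 0 <= p n <= 1) ->
  (p n / (ln (n%:R : R) / n%:R) `^ (6%:R^-1)) @[n --> \oo] --> +oo ->
  Gnp_prob (p n) [pred G : {set {set 'I_n}} | (tc 3 G <= 3)%N] @[n --> \oo]
    --> (1 : R).
Proof.
move=> p01 /cvgryPge p_large; apply/cvgrPdist_le => e e0.
near=> n.
have n12 : (12 <= n)%N by near: n; exact: nbhs_infty_ge.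
have n0 : (0 < n)%N by exact: leq_trans n12.
rewrite ger0_norm ?subr_ge0 ?Gnp_prob_le1 // lerBlDr -lerBlDl.
apply: (@le_trans _ _ (1 - n%:R ^+ 6 * (1 - p n ^+ 6) ^+ (n - 6))).
  rewrite lerD2l lerN2; apply: (@le_trans _ _ n%:R^-1).
    apply: missing_neighbour_bound => //.
    by near: n; exact: p_large.
  rewrite -[e]invrK lef_pV2 ?posrE ?invr_gt0 ?ltr0n //.
  by near: n; exact: nbhs_infty_ger.
apply: Gnp_prob_ge_common_neighbour => // G Gp.
apply: contraPP => /forallNP nbr; apply/negP; rewrite negbK /=.
apply/tc_leP; rewrite ?card_ord //.
apply: common_neighbour_coverable => // S S6.
(* A list shorter than six is padded with vertex 0, which only asks more of the common neighbour. *)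
pose t := [tuple nth (Ordinal n0) S i | i < 6].
have /negP := nbr t; rewrite negb_forall_in =>
  /exists_inP[w wt /negPn/subsetP wG].
exists w; apply/allP => x xS; apply: wG; apply: imset_f; rewrite inE.
have xi : (index x S < 6)%N by apply: leq_trans S6; rewrite index_mem.
apply/tnthP; exists (Ordinal xi).
by rewrite tnth_mktuple nth_index.
Unshelve. all: by end_near.
Qed.
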